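(* Let $M\in\mathbb{C}^{p\times p}$ be invertible, let $\mathcal{A}\in\mathbb{C}^{m\times m\times p}$ and $\mathcal{B}\in\mathbb{C}^{n\times n\times p}$ be nonsingular, let $\mathcal{C}\in\mathbb{C}^{m\times n\times p}$, let $\mathcal{A}=\mathcal{F}_1-\mathcal{G}_1$ and $\mathcal{B}=\mathcal{F}_2-\mathcal{G}_2$ with $\mathcal{F}_1,\mathcal{F}_2$ nonsingular, and let $\alpha,\beta>0$. Given $\mathcal{X}_0\in\mathbb{C}^{m\times n\times p}$ and $\mathcal{Y}_0=\mathcal{X}_0*_M\mathcal{B}$, define for $k\ge 0$ $$\mathcal{Y}_{k+1}=(\mathcal{I}_{mmp}-\alpha\mathcal{F}_1^{-1}*_M\mathcal{A})*_M\mathcal{Y}_k+\alpha\mathcal{F}_1^{-1}*_M\mathcal{C},$$ $$\mathcal{X}_{k+1}=\mathcal{X}_k*_M(\mathcal{I}_{nnp}-\beta\mathcal{B}*_M\mathcal{F}_2^{-1})+\beta\mathcal{Y}_{k+1}*_M\mathcal{F}_2^{-1}.$$ If $\rho(\mathcal{I}_{mmp}-\alpha\mathcal{F}_1^{-1}*_M\mathcal{A})<1$ and $\rho(\mathcal{I}_{nnp}-\beta\mathcal{B}*_M\mathcal{F}_2^{-1})<1$, then for every initial $\mathcal{X}_0$ (with $\mathcal{Y}_0=\mathcal{X}_0*_M\mathcal{B}$) the sequence $\{\mathcal{X}_k\}$ converges to $\mathcal{A}^{-1}*_M\mathcal{C}*_M\mathcal{B}^{-1}$.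
   Context: For $\mathcal{A}\in\mathbb{C}^{m\times n\times p}$, $\mathcal{A}(:,:,i)\in\mathbb{C}^{m\times n}$ ($1\le i\le p$) denotes the $i$-th frontal slice. For the fixed invertible matrix $M\in\mathbb{C}^{p\times p}$, $\tilde{\mathcal{A}}:=\mathcal{A}\times_3 M$ is defined by $\tilde{\mathcal{A}}(i_1,i_2,k)=\sum_{i_3=1}^p \mathcal{A}(i_1,i_2,i_3)M(k,i_3)$. The $M$-product of $\mathcal{A}\in\mathbb{C}^{m\times n\times p}$ and $\mathcal{B}\in\mathbb{C}^{n\times k\times p}$ is the tensor $\mathcal{A}*_M\mathcal{B}\in\mathbb{C}^{m\times k\times p}$ given by $\mathcal{A}*_M\mathcal{B}=\mathcal{W}\times_3 M^{-1}$, where $\mathcal{W}(:,:,i)=\tilde{\mathcal{A}}(:,:,i)\,\tilde{\mathcal{B}}(:,:,i)$ for $i=1,\dots,p$. The identity tensor $\mathcal{I}_{mmp}\in\mathbb{C}^{m\times m\times p}$ is the tensor such that each $\tilde{\mathcal{I}}_{mmp}(:,:,i)$ is the $m\times m$ identity matrix. $\mathcal{A}\in\mathbb{C}^{m\times m\times p}$ is nonsingular (invertible) if there is $\mathcal{Z}=:\mathcal{A}^{-1}$ with $\mathcal{A}*_M\mathcal{Z}=\mathcal{Z}*_M\mathcal{A}=\mathcal{I}_{mmp}$. The spectral radius of $\mathcal{A}\in\mathbb{C}^{m\times m\times p}$ is $\rho(\mathcal{A})=\max_{1\le i\le p}\rho(\tilde{\mathcal{A}}(:,:,i))$. Convergence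 of tensors is in the finite-dimensional space (entrywise). *)

(* Defs.v *)
From HB Require Import structures.
From mathcomp Require Import all_boot all_order all_algebra.
From mathcomp Require Import all_classical all_reals all_analysis.
From mathcomp Require Import complex.

Set Implicit Arguments.
Unset Strict Implicit.
Unset Printing Implicit Defensive.

Import Order.TTheory GRing.Theory Num.Theory numFieldNormedType.Exports.

Local Open Scope classical_set_scope.
Local Open Scope ring_scope.
Local Open Scope complex_scope.

(* A tensor in K^(m x n x p), stored as the family of its frontal slices:
   [A i] is A(:,:,i), and [A i3 i1 i2] is the entry A(i1,i2,i3). *)
Notation tensor K m n p := {ffun 'I_p -> 'M[K]_(m, n)}.

Definition mode3 (K : fieldType) (m n p q : nat)
    (A : tensor K m n p) (M : 'M[K]_(q, p)) : tensor K m n q :=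
  [ffun k => \matrix_(i1, i2) \sum_(i3 < p) A i3 i1 i2 * M k i3].

Definition tmul (K : fieldType) (p : nat) (M : 'M[K]_p) (m n k : nat)
    (A : tensor K m n p) (B : tensor K n k p) : tensor K m k p :=
  mode3 [ffun i => mode3 A M i *m mode3 B M i] (invmx M).

(* For invertible [M], the unique tensor all of whose transformed frontal
   slices are identity matrices; see [mode3_tid] and [mode3_inj]. *)
Definition tid (K : fieldType) (p : nat) (M : 'M[K]_p) (m : nat) :
    tensor K m m p :=
  mode3 [ffun=> 1%:M] (invmx M).

Definition is_tinv (K : fieldType) (p : nat) (M : 'M[K]_p) (m : nat)
    (A Z : tensor K m m p) : Prop :=
  tmul M A Z = tid M m /\ tmul M Z A = tid M m.

Definition tnonsingular (K : fieldType) (p : nat) (M : 'M[K]_p) (m : nat)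
    (A : tensor K m m p) : Prop :=
  exists Z, is_tinv M A Z.

(* The inverse of a nonsingular tensor, unique by [is_tinv_uniq];
   the default value 0 is used for singular tensors only. *)
Definition tinv (K : fieldType) (p : nat) (M : 'M[K]_p) (m : nat)
    (A : tensor K m m p) : tensor K m m p :=
  xget 0 [set Z | is_tinv M A Z].

(* The modulus is taken through [Normc.normc] because [`|a|] lives in [R[i]].
   The supremum is a maximum when [0 < m], and is 0 when [m = 0]. *)
Definition specrad (R : realType) (m : nat) (A : 'M[R[i]]_m) : R :=
  sup [set Normc.normc a | a in [set a : R[i] | eigenvalue A a]].

(* Spectral radii are nonnegative, so the unit 0 of the iterated maximum is
   harmless when [0 < p]. *)
Definition tspecrad (R : realType) (p : nat) (M : 'M[R[i]]_p) (m : nat)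
    (A : tensor R[i] m m p) : R :=
  \big[Num.max/0]_(i < p) specrad (mode3 A M i).

(* Entrywise convergence; [R[i]^o] is [R[i]] with the topology of its norm. *)
Definition tcvg (R : realType) (m n p : nat)
    (X : nat -> tensor R[i] m n p) (L : tensor R[i] m n p) : Prop :=
  forall i j l, (fun k : nat => X k l i j : R[i]^o) @ \oo --> (L l i j : R[i]^o).

Lemma mode3_comp (K : fieldType) (m n p q r : nat) (A : tensor K m n p)
    (M : 'M[K]_(q, p)) (N : 'M[K]_(r, q)) :
  mode3 (mode3 A M) N = mode3 A (N *m M).
Proof.
apply/ffunP => k; rewrite !ffunE; apply/matrixP => a b; rewrite !mxE.
under eq_bigr do rewrite ffunE mxE mulr_suml.
rewrite exchange_big; apply: eq_bigr => i _; rewrite mxE mulr_sumr.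
by apply: eq_bigr => j _; rewrite -mulrA [M _ _ * _]mulrC.
Qed.

Lemma mode3_1 (K : fieldType) (m n p : nat) (A : tensor K m n p) :
  mode3 A 1%:M = A.
Proof.
apply/ffunP => k; rewrite !ffunE; apply/matrixP => a b; rewrite !mxE.
rewrite (bigD1 k) //= big1 => [|i /negPf ik]; rewrite !mxE.
  by rewrite eqxx mulr1 addr0.
by rewrite eq_sym ik mulr0.
Qed.

Lemma mode3_inj (K : fieldType) (m n p : nat) (M : 'M[K]_p) :
  M \in unitmx -> injective (fun A : tensor K m n p => mode3 A M).
Proof.
move=> uM A B /(congr1 (fun T => mode3 T (invmx M))).
by rewrite !mode3_comp mulVmx // !mode3_1.
Qed.

Lemma mode3_tid (K : fieldType) (p : nat) (M : 'M[K]_p) (m : nat) :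
  M \in unitmx -> mode3 (tid M m) M = [ffun=> 1%:M].
Proof. by move=> uM; rewrite mode3_comp mulmxV // mode3_1. Qed.

Lemma mode3_tmul (K : fieldType) (p : nat) (M : 'M[K]_p) (m n k : nat)
    (A : tensor K m n p) (B : tensor K n k p) :
  M \in unitmx ->
  mode3 (tmul M A B) M = [ffun i => mode3 A M i *m mode3 B M i].
Proof. by move=> uM; rewrite mode3_comp mulmxV // mode3_1. Qed.

Lemma is_tinv_uniq (K : fieldType) (p : nat) (M : 'M[K]_p) (m : nat)
    (A Z1 Z2 : tensor K m m p) :
  M \in unitmx -> is_tinv M A Z1 -> is_tinv M A Z2 -> Z1 = Z2.
Proof.
move=> uM [_ Z1A] [AZ2 _]; apply: (mode3_inj uM); apply/ffunP => i.
have Z1Ai : mode3 Z1 M i *m mode3 A M i = 1%:M.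
  by have := congr1 (fun T => mode3 T M i) Z1A;
    rewrite /= mode3_tmul // mode3_tid // [LHS]ffunE [RHS]ffunE.
have AZ2i : mode3 A M i *m mode3 Z2 M i = 1%:M.
  by have := congr1 (fun T => mode3 T M i) AZ2;
    rewrite /= mode3_tmul // mode3_tid // [LHS]ffunE [RHS]ffunE.
by rewrite -[LHS]mulmx1 -AZ2i mulmxA Z1Ai mul1mx.
Qed.

Lemma tinvP (K : fieldType) (p : nat) (M : 'M[K]_p) (m : nat)
    (A : tensor K m m p) :
  tnonsingular M A -> is_tinv M A (tinv M A).
Proof. by move=> /(xgetPex 0). Qed.

(* Main.v *)
(* The transform by [M] turns the iteration into independent matrix iterations
   on the frontal slices, with iteration matrices S and T. The errors
   d_k = y_k - a^-1 c and e_k = x_k - a^-1 c b^-1 satisfy d_{k+1} = S d_k and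
   e_{k+1} = e_k T + (a null sequence once d_k -> 0). So it suffices to show
   that v_k -> 0 whenever v_{k+1} - v_k T -> 0 and all the eigenvalues z_1, ...,
   z_r of T have modulus < 1. By Cayley-Hamilton
   v_k (T - z_1) ... (T - z_r) = 0, and the factors are removed one at a time:
   if v_k (T - z) -> 0 then v_{k+1} - z v_k -> 0, an entrywise perturbed scalar
   contraction, hence v_k -> 0. *)
Require Import Defs.
From HB Require Import structures.
From mathcomp Require Import all_boot all_order all_algebra.
From mathcomp Require Import all_classical all_reals all_analysis.
From mathcomp Require Import complex.
From mathcomp Require Import lra.

Set Implicit Arguments.
Unset Strict Implicit.
Unset Printing Implicit Defensive.

Import Order.TTheory GRing.Theory Num.Theory numFieldNormedType.Exports.

Local Open Scope ring_scope.
Local Open Scope complex_scope.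

(** * Perturbed scalar contractions *)

Lemma contraction_cvg0 (R : realType) (r : R) (a b : nat -> R) :
  0 <= r < 1 -> (b @ \oo --> 0)%classic -> (forall k, 0 <= a k) ->
  (forall k, a k.+1 <= r * a k + b k) -> (a @ \oo --> 0)%classic.
Proof.
move=> /andP[r0 r1] b0 a0 ab; apply/cvgr0Pnorm_lt => e e0.
(* This threshold for [b] solves [r * (e / 2) + d = e / 2], so the term [e / 2] of [bound] survives
   the induction. *)
have d0 : 0 < (1 - r) * (e / 2) by rewrite mulr_gt0 ?subr_gt0 ?divr_gt0.
have /cvgr0Pnorm_lt /(_ _ d0) [N _ bN] := b0.
have bound j : a (N + j)%N <= e / 2 + r ^+ j * a N.
  elim: j => [|j IHj]; first by rewrite addn0 expr0 mul1r lerDr; lra.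
  rewrite addnS (le_trans (ab _)) // exprS.
  have bNj : `|b (N + j)%N| < (1 - r) * (e / 2) by apply: bN; rewrite /= leq_addr.
  have {bNj} := le_lt_trans (ler_norm _) bNj.
  have := ler_wpM2l r0 IHj; lra.
have rj0 : ((fun j => r ^+ j * a N) @ \oo --> (0 : R))%classic.
  rewrite -[X in (_ --> X)%classic](mul0r (a N)); apply: cvgMr_tmp.
  by apply: cvg_expr; rewrite ger0_norm.
have e20 : 0 < e / 2 by rewrite divr_gt0.
have /cvgr0Pnorm_lt /(_ _ e20) [K _ rK] := rj0.
exists (N + K)%N => // k /= NKk.
have Nk : (N <= k)%N := leq_trans (leq_addr _ _) NKk.
have Kk : (K <= k - N)%N by rewrite leq_subRL.
have /= := le_lt_trans (ler_norm _) (rK _ Kk).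
rewrite ger0_norm //; have := bound (k - N)%N; rewrite subnKC //; lra.
Qed.

Lemma normc_ge0 (R : rcfType) (z : R[i]) : 0 <= Normc.normc z.
Proof. by case: z => x y; exact: sqrtr_ge0. Qed.

(** Bridge between limits in [R[i]], where the norm and the epsilons are themselves complex, and
    limits of real moduli. *)
Lemma cvg0_normc (R : realType) (u : nat -> R[i]) :
  ((fun k => u k : R[i]^o) @ \oo --> (0 : R[i]^o))%classic <->
  ((fun k => Normc.normc (u k)) @ \oo --> (0 : R))%classic.
Proof.
split=> u0; apply/cvgr0Pnorm_lt => e e0.
  have eC0 : 0 < e%:C :> R[i] by rewrite ltcR.
  have /cvgr0Pnorm_lt /(_ _ eC0) := u0; apply: filterS => k /=.
  by rewrite [`|Normc.normc _|]ger0_norm ?normc_ge0 // -ltcR.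
(* A positive element of [R[i]] has zero imaginary part. *)
have {e e0} [eR eR0 ->] : exists2 x : R, 0 < x & e = x%:C.
  case: e e0 => x y; rewrite ltcE /= => /andP[/eqP -> x0].
  by exists x.
have /cvgr0Pnorm_lt /(_ _ eR0) := u0; apply: filterS => k /=.
by rewrite [`|Normc.normc _|]ger0_norm ?normc_ge0 // -ltcR.
Qed.

(** By the triangle inequality, the moduli of [u] form a contraction of ratio [|z|] perturbed by the
    modulus of [u k.+1 - u k * z]. *)
Lemma cvg0_shift_scale (R : realType) (z : R[i]) (u : nat -> R[i]) :
  Normc.normc z < 1 ->
  ((fun k => u k.+1 - u k * z : R[i]^o) @ \oo --> (0 : R[i]^o))%classic ->
  ((fun k => u k : R[i]^o) @ \oo --> (0 : R[i]^o))%classic.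
Proof.
move=> z1 /cvg0_normc uz; apply/cvg0_normc.
apply: (contraction_cvg0 (r := Normc.normc z) _ uz) => [|k|k].
- by rewrite normc_ge0.
- exact: normc_ge0.
by rewrite -{1}(subrK (u k * z) (u k.+1)) addrC mulrC -Normc.normcM le_normcD.
Qed.

(** * Null sequences of matrices and perturbed linear recurrences *)

(** Kept entrywise, as in [tcvg], so that the scalar lemmas apply to each entry. *)
Definition mx_null (R : realType) (m n : nat) (V : nat -> 'M[R[i]]_(m, n)) :=
  forall i j, ((fun k => V k i j : R[i]^o) @ \oo --> (0 : R[i]^o))%classic.

Lemma cvg0_sum (R : realType) (I : finType) (u : I -> nat -> R[i]^o) :
  (forall i, (u i @ \oo --> (0 : R[i]^o))%classic) ->
  ((fun k => \sum_i u i k) @ \oo --> (0 : R[i]^o))%classic.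
Proof.
move=> u0; rewrite -[X in (_ --> X)%classic](@big1 _ _ +%R I (index_enum I) predT (fun=> 0)) //.
apply: cvg_big => //.
exact: add_continuous.
Qed.

Lemma mx_nullD (R : realType) (m n : nat) (V W : nat -> 'M[R[i]]_(m, n)) :
  mx_null V -> mx_null W -> mx_null (fun k => V k + W k).
Proof.
move=> V0 W0 i j; under eq_fun do rewrite mxE.
have : ((fun k => V k i j + W k i j : R[i]^o) @ \oo --> (0 + 0 : R[i]^o))%classic.
  exact: cvgD (V0 i j) (W0 i j).
by rewrite addr0.
Qed.

Lemma mx_nullMr (R : realType) (m n q : nat) (V : nat -> 'M[R[i]]_(m, n))
    (N : 'M[R[i]]_(n, q)) :
  mx_null V -> mx_null (fun k => V k *m N).
Proof.
move=> V0 i j; under eq_fun do rewrite mxE.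
apply: cvg0_sum => l.
have : ((fun k => V k i l * N l j : R[i]^o) @ \oo --> (0 * N l j : R[i]^o))%classic.
  exact: cvgMr_tmp (V0 i l).
by rewrite mul0r.
Qed.

Lemma mx_null_prod (R : realType) (m n : nat) (T : 'M[R[i]]_n.+1) (s : seq R[i])
    (V : nat -> 'M[R[i]]_(m, n.+1)) :
  (forall z, z \in s -> Normc.normc z < 1) ->
  mx_null (fun k => V k.+1 - V k *m T) ->
  mx_null (fun k => V k *m \prod_(z <- s) (T - z%:M)) -> mx_null V.
Proof.
elim: s V => [|z s IHs] V s1 VT.
  by under [X in mx_null X]eq_fun do rewrite big_nil mulmx1.
under [X in mx_null X]eq_fun do rewrite big_cons -mulmxE mulmxA.
move=> /(IHs _ (fun y ys => s1 y (mem_behead (s := z :: s) ys))) Vz0.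
have {}Vz0 : mx_null (fun k => V k *m (T - z%:M)).
  (* Since [T] commutes with [T - z%:M], the sequence [V k *m (T - z%:M)] obeys the same perturbed
     recurrence as [V]. *)
  apply: Vz0; rewrite [X in mx_null X](_ : _ =
    fun k => (V k.+1 - V k *m T) *m (T - z%:M)); first exact: mx_nullMr.
  apply/funext => k; rewrite mulmxBl -!mulmxA; congr (_ - _ *m _).
  by rewrite mulmxBl mulmxBr scalar_mxC.
move=> i j; apply: (@cvg0_shift_scale _ z); first exact/s1/mem_head.
(* Here [V k.+1 - z *: V k] is split into two null sequences: the defect of the recurrence and
   [V k *m (T - z%:M)]. *)
rewrite [X in (X @ _)%classic](_ : _ =
  fun k => (V k.+1 - V k *m T + V k *m (T - z%:M)) i j).
  exact: mx_nullD VT Vz0 i j.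
apply/funext => k; rewrite mulmxBr mul_mx_scalar addrA subrK !mxE.
by rewrite [z * _]mulrC.
Qed.

Lemma mx_null_recurrence (R : realType) (m n : nat) (T : 'M[R[i]]_n)
    (V : nat -> 'M[R[i]]_(m, n)) :
  (forall z, eigenvalue T z -> Normc.normc z < 1) ->
  mx_null (fun k => V k.+1 - V k *m T) -> mx_null V.
Proof.
case: n T V => [|n] T V T1 VT; first by move=> i [].
have [s sE] := closed_field_poly_normal (char_poly T).
move: sE; rewrite (monicP (char_poly_monic T)) scale1r => sE.
apply: (@mx_null_prod _ _ _ T s) => // [z zs|].
  by apply: T1; rewrite eigenvalue_root_char sE root_prod_XsubC.
(* The product is the factored characteristic polynomial evaluated at [T]. *)
have -> : \prod_(z <- s) (T - z%:M) = 0.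
  rewrite -(Cayley_Hamilton T) sE rmorph_prod; apply: eq_bigr => z _.
  by rewrite rmorphB /= horner_mx_X horner_mx_C.
by move=> i j; under eq_fun do rewrite mulmx0 mxE; exact: cvg_cst.
Qed.

Lemma eigenvalue_trmx (K : fieldType) (n : nat) (T : 'M[K]_n) (z : K) :
  eigenvalue T^T z = eigenvalue T z.
Proof.
rewrite !eigenvalue_root_char /char_poly -[in RHS]det_tr; congr (root (\det _) z).
by apply/matrixP => i j; rewrite !mxE eq_sym.
Qed.

(** Transposition exchanges left and right multiplication and preserves the spectrum. *)
Lemma mx_null_recurrence_l (R : realType) (m n : nat) (S : 'M[R[i]]_m)
    (V : nat -> 'M[R[i]]_(m, n)) :
  (forall z, eigenvalue S z -> Normc.normc z < 1) ->
  mx_null (fun k => V k.+1 - S *m V k) -> mx_null V.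
Proof.
move=> S1 VS i j; have : mx_null (fun k => (V k)^T).
  apply: (mx_null_recurrence (T := S^T)) => [z|j' i'].
    by rewrite eigenvalue_trmx; exact: S1.
  by under eq_fun do rewrite -trmx_mul -linearB mxE; exact: VS.
by move=> /(_ j i); under eq_fun do rewrite mxE.
Qed.

(** * From spectral radii to eigenvalues *)

Lemma eigenvalue_normc_le (R : realType) (n : nat) (T : 'M[R[i]]_n) (z : R[i]) :
  eigenvalue T z -> Normc.normc z <= specrad T.
Proof.
move=> Tz; apply: ub_le_sup; last by exists z.
have [s sE] := closed_field_poly_normal (char_poly T).
(* A [sup] dominates its set only once an upper bound is known; the largest modulus of a root of the
   characteristic polynomial is one. *)
exists (\big[Num.max/0]_(y <- s) Normc.normc y) => _ [y Ty <-].
apply: le_bigmax_seq => //.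
move: Ty; rewrite /= eigenvalue_root_char sE (monicP (char_poly_monic T)).
by rewrite scale1r root_prod_XsubC.
Qed.

Lemma tspecrad_lt1 (R : realType) (p : nat) (M : 'M[R[i]]_p) (m : nat)
    (A : tensor R[i] m m p) :
  tspecrad M A < 1 ->
  forall i z, eigenvalue (mode3 A M i) z -> Normc.normc z < 1.
Proof.
move=> A1 i z /eigenvalue_normc_le zA; apply: le_lt_trans A1.
by apply: le_trans zA _; exact: le_bigmax.
Qed.

(** * Linearity of the transform and reduction to slices *)

Lemma mode3D (K : fieldType) (m n p q : nat) (A B : tensor K m n p)
    (M : 'M[K]_(q, p)) :
  mode3 (A + B) M = mode3 A M + mode3 B M.
Proof.
apply/ffunP => k; rewrite !ffunE; apply/matrixP => i j; rewrite !mxE -big_split.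
by apply: eq_bigr => l _; rewrite !ffunE mxE mulrDl.
Qed.

Lemma mode3Z (K : fieldType) (m n p q : nat) (c : K) (A : tensor K m n p)
    (M : 'M[K]_(q, p)) :
  mode3 (c *: A) M = c *: mode3 A M.
Proof.
apply/ffunP => k; rewrite !ffunE; apply/matrixP => i j; rewrite !mxE mulr_sumr.
by apply: eq_bigr => l _; rewrite !ffunE mxE mulrA.
Qed.

Lemma mode3N (K : fieldType) (m n p q : nat) (A : tensor K m n p)
    (M : 'M[K]_(q, p)) :
  mode3 (- A) M = - mode3 A M.
Proof. by rewrite -scaleN1r mode3Z scaleN1r. Qed.

(** Undoing the transform writes each entry of [X k - L] as a fixed linear combination of entries of
    the transformed errors, with coefficients from a row of [invmx M]. *)
Lemma tcvg_slices (R : realType) (m n p : nat) (M : 'M[R[i]]_p)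
    (X : nat -> tensor R[i] m n p) (L : tensor R[i] m n p) :
  M \in unitmx ->
  (forall i, mx_null (fun k => mode3 (X k) M i - mode3 L M i)) -> tcvg X L.
Proof.
move=> uM XL i j l.
have XLE k : X k l i j - L l i j =
    \sum_q ((mode3 (X k) M q - mode3 L M q) *m (invmx M l q)%:M) i j.
  rewrite -[X k in LHS]mode3_1 -[L in LHS]mode3_1 -(mulVmx uM) -!mode3_comp.
  rewrite ![mode3 (mode3 _ _) _ _]ffunE !mxE -sumrB; apply: eq_bigr => q _.
  by rewrite mul_mx_scalar !mxE mulrBr ![invmx M l q * _]mulrC.
have XL0 : ((fun k => X k l i j - L l i j : R[i]^o) @ \oo --> (0 : R[i]^o))%classic.
  rewrite (funext XLE).
  by apply: cvg0_sum => q; exact: mx_nullMr (XL q) i j.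
exact: cvg_zero XL0.
Qed.

(** * The two-step iteration on a single slice *)

(** The limits [a' *m c] and [a' *m c *m b'] are fixed points of the two updates ([Sfix], [Tfix]);
    subtracting these identities leaves recurrences for the errors. *)
Lemma mx_null_splitting (R : realType) (m n : nat) (a a' f : 'M[R[i]]_m)
    (b b' g : 'M[R[i]]_n) (c : 'M[R[i]]_(m, n)) (al be : R[i])
    (x y : nat -> 'M[R[i]]_(m, n)) :
  a *m a' = 1%:M -> b' *m b = 1%:M ->
  (forall z, eigenvalue (1%:M - al *: (f *m a)) z -> Normc.normc z < 1) ->
  (forall z, eigenvalue (1%:M - be *: (b *m g)) z -> Normc.normc z < 1) ->
  (forall k, y k.+1 = (1%:M - al *: (f *m a)) *m y k + al *: (f *m c)) ->
  (forall k, x k.+1 = x k *m (1%:M - be *: (b *m g)) + be *: (y k.+1 *m g)) ->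
  mx_null (fun k => x k - a' *m c *m b').
Proof.
move=> aa' b'b; set S := _ - _; set T := _ - _ => rS rT yS xS.
have Sfix : S *m (a' *m c) + al *: (f *m c) = a' *m c.
  rewrite mulmxBl mul1mx -scalemxAl -mulmxA [a *m _]mulmxA aa' mul1mx.
  by rewrite subrK.
have Tfix : a' *m c *m b' *m T + be *: (a' *m c *m g) = a' *m c *m b'.
  rewrite mulmxBr mulmx1 -scalemxAr -[_ *m b' *m _]mulmxA [b' *m _]mulmxA.
  by rewrite b'b mul1mx subrK.
have y_null : mx_null (fun k => y k - a' *m c).
  apply: (mx_null_recurrence_l rS) => i j.
  under eq_fun => k do
    rewrite yS -[X in _ - X - _]Sfix opprD addrACA subrr addr0 mulmxBr subrr mxE.
  exact: cvg_cst.
apply: (mx_null_recurrence rT).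
(* The update of [x] uses the new iterate [y k.+1], so the perturbation involves the shifted
   error. *)
have y_nullS : mx_null (fun k => y k.+1 - a' *m c).
  by move=> i j; rewrite (cvg_shiftS (fun k => (y k - a' *m c) i j : R[i]^o)).
rewrite [X in mx_null X](_ : _ = fun k => (y k.+1 - a' *m c) *m (be *: g)).
  exact: mx_nullMr.
apply/funext => k.
rewrite xS -[X in _ - X - _]Tfix opprD addrACA -mulmxBl addrAC subrr add0r.
by rewrite -scalerBr -mulmxBl scalemxAr.
Qed.

(** * Slices of products and inverses, and the assembly over all slices *)

Lemma mode3_tmul_slice (K : fieldType) (p : nat) (M : 'M[K]_p) (m n k : nat)
    (A : tensor K m n p) (B : tensor K n k p) (i : 'I_p) :
  M \in unitmx ->
  mode3 (tmul M A B) M i = mode3 A M i *m mode3 B M i.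
Proof. by move=> uM; rewrite mode3_tmul // [LHS]ffunE. Qed.

Lemma mode3_tid_slice (K : fieldType) (p : nat) (M : 'M[K]_p) (m : nat)
    (i : 'I_p) :
  M \in unitmx -> mode3 (tid M m) M i = 1%:M.
Proof. by move=> uM; rewrite mode3_tid // [LHS]ffunE. Qed.

Lemma mulmx_tinv_slice (K : fieldType) (p : nat) (M : 'M[K]_p) (m : nat)
    (A : tensor K m m p) (i : 'I_p) :
  M \in unitmx -> tnonsingular M A ->
  mode3 A M i *m mode3 (tinv M A) M i = 1%:M.
Proof.
move=> uM /tinvP[/(congr1 (fun T => mode3 T M i)) /= + _].
by rewrite mode3_tmul_slice // mode3_tid_slice.
Qed.

Theorem theorem3p3 (R : realType) (m n p : nat) (M : 'M[R[i]]_p)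
    (A F1 G1 : tensor R[i] m m p) (B F2 G2 : tensor R[i] n n p)
    (C : tensor R[i] m n p) (alpha beta : R)
    (hM : M \in unitmx)
    (hA : tnonsingular M A) (hB : tnonsingular M B)
    (splitA : A = F1 - G1) (splitB : B = F2 - G2)
    (hF1 : tnonsingular M F1) (hF2 : tnonsingular M F2)
    (alpha_gt0 : 0 < alpha) (beta_gt0 : 0 < beta)
    (rho1 : tspecrad M (tid M m - alpha%:C *: tmul M (tinv M F1) A) < 1)
    (rho2 : tspecrad M (tid M n - beta%:C *: tmul M B (tinv M F2)) < 1)
    (X0 : tensor R[i] m n p) (X Y : nat -> tensor R[i] m n p)
    (hX0 : X 0%N = X0) (hY0 : Y 0%N = tmul M X0 B)
    (hY : forall k : nat,
      Y k.+1 = tmul M (tid M m - alpha%:C *: tmul M (tinv M F1) A) (Y k)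
               + alpha%:C *: tmul M (tinv M F1) C)
    (hX : forall k : nat,
      X k.+1 = tmul M (X k) (tid M n - beta%:C *: tmul M B (tinv M F2))
               + beta%:C *: tmul M (Y k.+1) (tinv M F2)) :
  tcvg X (tmul M (tmul M (tinv M A) C) (tinv M B)).
Proof.
have slice1M (q : nat) (c : R[i]) (U V : tensor R[i] q q p) i :
    mode3 (tid M q - c *: tmul M U V) M i =
    1%:M - c *: (mode3 U M i *m mode3 V M i).
  rewrite mode3D mode3N mode3Z [LHS]ffunE [X in _ + X]ffunE [X in - X]ffunE.
  by rewrite mode3_tid_slice // mode3_tmul_slice.
apply: (tcvg_slices hM) => i; rewrite !mode3_tmul_slice //.
apply: (mx_null_splitting (a := mode3 A M i) (f := mode3 (tinv M F1) M i)
  (b := mode3 B M i) (g := mode3 (tinv M F2) M i) (al := alpha%:C)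
  (be := beta%:C) (y := fun k => mode3 (Y k) M i)).
- exact: mulmx_tinv_slice.
(* For [B] the inverse is needed on the left; one-sided inverses of square matrices are
   two-sided. *)
- exact/mulmx1C/mulmx_tinv_slice.
- by rewrite -slice1M; exact: tspecrad_lt1.
- by rewrite -slice1M; exact: tspecrad_lt1.
- move=> k; rewrite hY mode3D mode3Z [LHS]ffunE [X in _ + X]ffunE.
  rewrite [X in X + _](mode3_tmul_slice _ (Y k) i hM).
  rewrite [X in _ + _ *: X](mode3_tmul_slice _ C i hM).
  by rewrite slice1M.
- move=> k; rewrite hX mode3D mode3Z [LHS]ffunE [X in _ + X]ffunE.
  rewrite [X in X + _](mode3_tmul_slice (X k) _ i hM).
  rewrite [X in _ + _ *: X](mode3_tmul_slice (Y k.+1) _ i hM).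
  by rewrite slice1M.
Qed.
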